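(* For every $\mathcal{L}_{\mathrm{BPL}}$-formula $A$: $A$ is provable in $\mathsf{BPL}$ if and only if both sequents $\top\Rightarrow A$ and $A\Rightarrow\top$ are derivable in $\mathsf{S_{RBL}}$.
   Context: $\mathcal{L}_{\mathrm{BPL}}$-formulas are built from propositional letters and $\bot,\top$ by $\wedge,\vee,\rightarrow$; $\mathcal{L}_{\mathrm{RBL}}$-formulas additionally use the binary connectives $\cdot$ and $\leftarrow$. $\mathsf{BPL}$ (Visser's basic propositional logic) is the Hilbert system with axioms (for all formulas $A,B,C$): $A\rightarrow A$; $A\rightarrow(B\rightarrow A)$; $(A\rightarrow B)\wedge(B\rightarrow C)\rightarrow(A\rightarrow C)$; $(A\rightarrow C)\wedge(B\rightarrow C)\rightarrow(A\vee B\rightarrow C)$; $A\wedge B\rightarrow A$; $A\wedge B\rightarrow B$; $A\rightarrow A\vee B$; $B\rightarrow A\vee B$; $A\rightarrow(B\rightarrow A\wedge B)$; $(A\rightarrow B)\wedge(A\rightarrow C)\rightarrow(A\rightarrow B\wedge C)$; $A\wedge(B\vee C)\rightarrow(A\wedge B)\vee(A\wedge C)$; $\bot\rightarrow A$; and modus ponens. The system $\mathsf{S_{RBL}}$ derives sequents $A\Rightarrow B$ between $\mathcal{L}_{\mathrm{RBL}}$-formulas from the axioms $A\Rightarrow A$; $\bot\Rightarrow A$; $A\Rightarrow\top$; $A\wedge(B\vee C)\Rightarrow(A\wedge B)\vee(A\wedge C)$; $A\cdot\top\Rightarrow A$; $\top\cdot A\Rightarrow A$; $A\cdot B\Rightarrow(A\cdot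 B)\cdot B$; using the rules: Cut (from $A\Rightarrow B$ and $B\Rightarrow C$ infer $A\Rightarrow C$); from $A\cdot B\Rightarrow C$ infer $B\Rightarrow A\rightarrow C$ and conversely; from $A\cdot B\Rightarrow C$ infer $A\Rightarrow C\leftarrow B$ and conversely; from $A_i\Rightarrow B$ infer $A_1\wedge A_2\Rightarrow B$; from $C\Rightarrow A$ and $C\Rightarrow B$ infer $C\Rightarrow A\wedge B$; from $A\Rightarrow C$ and $B\Rightarrow C$ infer $A\vee B\Rightarrow C$; from $C\Rightarrow A_i$ infer $C\Rightarrow A_1\vee A_2$ ($i=1,2$).
   Formalization: The axiom A → ⊤ is added to BPL, because the listed axioms do not mention ⊤ and leave ⊤ unprovable although ⊤ ⇒ ⊤ is derivable; no new ⊤-free formula becomes provable. *)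

(* Defs.v *)
Inductive bpl_form : Type :=
| BVar : nat -> bpl_form
| BBot : bpl_form
| BTop : bpl_form
| BAnd : bpl_form -> bpl_form -> bpl_form
| BOr  : bpl_form -> bpl_form -> bpl_form
| BImp : bpl_form -> bpl_form -> bpl_form.

Inductive rbl_form : Type :=
| RVar : nat -> rbl_form
| RBot : rbl_form
| RTop : rbl_form
| RAnd : rbl_form -> rbl_form -> rbl_form
| ROr  : rbl_form -> rbl_form -> rbl_form
| RImp : rbl_form -> rbl_form -> rbl_form
| RDot : rbl_form -> rbl_form -> rbl_form
| RPmi : rbl_form -> rbl_form -> rbl_form.

Declare Scope bpl_scope.
Delimit Scope bpl_scope with bpl.
Bind Scope bpl_scope with bpl_form.
Notation "⊥" := BBot : bpl_scope.
Notation "⊤" := BTop : bpl_scope.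
Notation "A ∧ B" := (BAnd A B) (at level 80, right associativity) : bpl_scope.
Notation "A ∨ B" := (BOr A B) (at level 85, right associativity) : bpl_scope.
Notation "A → B" := (BImp A B)
  (at level 99, B at level 200, right associativity) : bpl_scope.

Declare Scope rbl_scope.
Delimit Scope rbl_scope with rbl.
Bind Scope rbl_scope with rbl_form.
Notation "⊥" := RBot : rbl_scope.
Notation "⊤" := RTop : rbl_scope.
Notation "A · B" := (RDot A B) (at level 40, left associativity) : rbl_scope.
Notation "A ∧ B" := (RAnd A B) (at level 80, right associativity) : rbl_scope.
Notation "A ∨ B" := (ROr A B) (at level 85, right associativity) : rbl_scope.
Notation "A → B" := (RImp A B)
  (at level 99, B at level 200, right associativity) : rbl_scope.
(* [C ← B] is the residual with [A · B ⇒ C] iff [A ⇒ C ← B]. *)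
Notation "C ← B" := (RPmi C B) (at level 90, no associativity) : rbl_scope.

Fixpoint embed (A : bpl_form) : rbl_form :=
  match A with
  | BVar p => RVar p
  | BBot => RBot
  | BTop => RTop
  | BAnd A B => RAnd (embed A) (embed B)
  | BOr A B => ROr (embed A) (embed B)
  | BImp A B => RImp (embed A) (embed B)
  end.

(* [⊤] is a primitive constant here, so it needs [bpl_top]: no other axiom
   mentions [⊤], and without it [⊤] would act as one more propositional letter,
   hence would not be provable.  Over the other axioms, [bpl_top] is equivalent
   to the single axiom [⊤].  On formulas without [⊤] it adds no theorems, since
   replacing [⊤] by [⊥ → ⊥] turns its instances into theorems of the rest. *)
Inductive BPL : bpl_form -> Prop :=
| bpl_id (A : bpl_form) : BPL (A → A)
| bpl_k (A B : bpl_form) : BPL (A → (B → A))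
| bpl_trans (A B C : bpl_form) : BPL ((A → B) ∧ (B → C) → (A → C))
| bpl_or_elim (A B C : bpl_form) : BPL ((A → C) ∧ (B → C) → (A ∨ B → C))
| bpl_and_l (A B : bpl_form) : BPL (A ∧ B → A)
| bpl_and_r (A B : bpl_form) : BPL (A ∧ B → B)
| bpl_or_l (A B : bpl_form) : BPL (A → A ∨ B)
| bpl_or_r (A B : bpl_form) : BPL (B → A ∨ B)
| bpl_pair (A B : bpl_form) : BPL (A → (B → A ∧ B))
| bpl_and_intro (A B C : bpl_form) : BPL ((A → B) ∧ (A → C) → (A → B ∧ C))
| bpl_distr (A B C : bpl_form) : BPL (A ∧ (B ∨ C) → (A ∧ B) ∨ (A ∧ C))
| bpl_bot (A : bpl_form) : BPL (⊥ → A)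
| bpl_top (A : bpl_form) : BPL (A → ⊤)
| bpl_mp (A B : bpl_form) : BPL (A → B) -> BPL A -> BPL B.

Reserved Notation "A ⇒ B" (at level 100, no associativity).

Inductive SRBL : rbl_form -> rbl_form -> Prop :=
| srbl_id (A : rbl_form) : A ⇒ A
| srbl_bot (A : rbl_form) : ⊥ ⇒ A
| srbl_top (A : rbl_form) : A ⇒ ⊤
| srbl_distr (A B C : rbl_form) : A ∧ (B ∨ C) ⇒ (A ∧ B) ∨ (A ∧ C)
| srbl_dot_top (A : rbl_form) : A · ⊤ ⇒ A
| srbl_top_dot (A : rbl_form) : ⊤ · A ⇒ A
| srbl_contr (A B : rbl_form) : A · B ⇒ (A · B) · B
| srbl_cut (A B C : rbl_form) : (A ⇒ B) -> (B ⇒ C) -> (A ⇒ C)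
| srbl_imp (A B C : rbl_form) : (A · B ⇒ C) -> (B ⇒ (A → C))
| srbl_imp_inv (A B C : rbl_form) : (B ⇒ (A → C)) -> (A · B ⇒ C)
| srbl_pmi (A B C : rbl_form) : (A · B ⇒ C) -> (A ⇒ (C ← B))
| srbl_pmi_inv (A B C : rbl_form) : (A ⇒ (C ← B)) -> (A · B ⇒ C)
| srbl_and_left1 (A1 A2 B : rbl_form) : (A1 ⇒ B) -> (A1 ∧ A2 ⇒ B)
| srbl_and_left2 (A1 A2 B : rbl_form) : (A2 ⇒ B) -> (A1 ∧ A2 ⇒ B)
| srbl_and_right (A B C : rbl_form) : (C ⇒ A) -> (C ⇒ B) -> (C ⇒ A ∧ B)
| srbl_or_left (A B C : rbl_form) : (A ⇒ C) -> (B ⇒ C) -> (A ∨ B ⇒ C)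
| srbl_or_right1 (A1 A2 C : rbl_form) : (C ⇒ A1) -> (C ⇒ A1 ∨ A2)
| srbl_or_right2 (A1 A2 C : rbl_form) : (C ⇒ A2) -> (C ⇒ A1 ∨ A2)
where "A ⇒ B" := (SRBL A B).

(* Main.v *)
(* From left to right, an Aczel slash handles modus ponens: [⊤ ⇒ A → B] does
   not yield [A ⇒ B] inside SRBL, so the induction carries the stronger
   property [slash].
   From right to left, SRBL is interpreted in the ideals of the lattice of
   filters of the Lindenbaum algebra of BPL, filters being ordered by reverse
   inclusion.  On filters the product is [F · G = {c | a ∈ F, a → c ∈ G}]; it
   preserves finite joins (intersections), so its extension to ideals has both
   residuals.  A BPL-formula [a] is interpreted by the filters that contain
   [a], and evaluating at the filter of theorems gives the claim. *)

Require Import Defs.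

(** * From BPL to SRBL *)

Lemma srbl_dot_mono A A' B B' :
  (A ⇒ A') -> (B ⇒ B') -> ((A · B)%rbl ⇒ (A' · B')%rbl).
Proof.
  intros HA HB.
  apply srbl_cut with (A' · B)%rbl.
  - apply srbl_pmi_inv, srbl_cut with A'; [exact HA|].
    apply srbl_pmi, srbl_id.
  - apply srbl_imp_inv, srbl_cut with B'; [exact HB|].
    apply srbl_imp, srbl_id.
Qed.

Lemma srbl_dot_fst A B : (A · B)%rbl ⇒ A.
Proof.
  apply srbl_cut with (A · ⊤)%rbl; [|apply srbl_dot_top].
  apply srbl_dot_mono; [apply srbl_id | apply srbl_top].
Qed.

Lemma srbl_dot_snd A B : (A · B)%rbl ⇒ B.
Proof.
  apply srbl_cut with (⊤ · B)%rbl; [|apply srbl_top_dot].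
  apply srbl_dot_mono; [apply srbl_top | apply srbl_id].
Qed.

Lemma srbl_top_elim A B : (RTop ⇒ A) -> (B ⇒ A).
Proof. intros H; apply srbl_cut with RTop; [apply srbl_top | exact H]. Qed.

Lemma srbl_and_fst A B : (A ∧ B)%rbl ⇒ A.
Proof. apply srbl_and_left1, srbl_id. Qed.

Lemma srbl_and_snd A B : (A ∧ B)%rbl ⇒ B.
Proof. apply srbl_and_left2, srbl_id. Qed.

(** The implication clause asks for [embed A ⇒ embed B], which is stronger than
    [⊤ ⇒ (embed A → embed B)]: the cases of nested implications below cut with such sequents. *)
Fixpoint slash (A : bpl_form) : Prop :=
  match A with
  | BVar _ | BBot => False
  | BTop => True
  | BAnd A B => slash A /\ slash B
  | BOr A B => slash A \/ slash B
  | BImp A B => (embed A ⇒ embed B) /\ (slash A -> slash B)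
  end.

Lemma slash_srbl A : slash A -> RTop ⇒ embed A.
Proof.
  induction A as [p| | |A IHA B IHB|A IHA B IHB|A IHA B IHB]; cbn.
  - tauto.
  - tauto.
  - intros _; apply srbl_id.
  - intros [HA HB]; apply srbl_and_right; auto.
  - intros [HA|HB]; [apply srbl_or_right1 | apply srbl_or_right2]; auto.
  - intros [H _]; apply srbl_imp.
    apply srbl_cut with (embed A); [apply srbl_dot_fst | exact H].
Qed.

Lemma bpl_slash A : BPL A -> slash A.
Proof.
  induction 1 as [A|A B|A B C|A B C|A B|A B|A B|A B|A B|A B C|A B C|A|A
                 |A B _ IHAB _ IHA]; cbn.
  - split; [apply srbl_id | tauto].
  - split; [apply srbl_imp, srbl_dot_snd|].
    intros HA; split; [apply srbl_top_elim, slash_srbl, HA | tauto].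
  - split.
    (* Contraction doubles the right factor: one copy of the conjunction takes [A] to [B], the other
       takes [B] to [C]. *)
    + apply srbl_imp; eapply srbl_cut; [apply srbl_contr|].
      eapply srbl_cut; [|apply srbl_imp_inv, srbl_and_snd].
      apply srbl_dot_mono; [|apply srbl_id].
      apply srbl_imp_inv, srbl_and_fst.
    + intros [[HAB sAB] [HBC sBC]]; split; [|tauto].
      exact (srbl_cut _ _ _ HAB HBC).
  - split.
    (* Moving the right factor across with [←] leaves the disjunction alone on the left, where it
       can be split. *)
    + apply srbl_imp, srbl_pmi_inv, srbl_or_left; apply srbl_pmi, srbl_imp_inv.
      * apply srbl_and_fst.
      * apply srbl_and_snd.
    + intros [[HAC sAC] [HBC sBC]]; split; [|tauto].
      apply srbl_or_left; assumption.
  - split; [apply srbl_and_fst | tauto].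
  - split; [apply srbl_and_snd | tauto].
  - split; [apply srbl_or_right1, srbl_id | tauto].
  - split; [apply srbl_or_right2, srbl_id | tauto].
  - split.
    + apply srbl_imp, srbl_and_right; [apply srbl_dot_snd | apply srbl_dot_fst].
    + intros HA; split; [|tauto].
      apply srbl_and_right; [apply srbl_top_elim, slash_srbl, HA | apply srbl_id].
  - split.
    + apply srbl_imp, srbl_and_right; apply srbl_imp_inv.
      * apply srbl_and_fst.
      * apply srbl_and_snd.
    + intros [[HAB sAB] [HAC sAC]]; split; [|tauto].
      apply srbl_and_right; assumption.
  - split; [apply srbl_distr | tauto].
  - split; [apply srbl_bot | tauto].
  - split; [apply srbl_top | tauto].
  - apply IHAB, IHA.
Qed.

(** * The Lindenbaum algebra of BPL *)

Lemma bpl_conj A B : BPL A -> BPL B -> BPL (A ∧ B).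
Proof.
  intros HA HB; apply bpl_mp with B; [|exact HB].
  apply bpl_mp with A; [apply bpl_pair | exact HA].
Qed.

Lemma bpl_weaken A B : BPL B -> BPL (A → B).
Proof. apply bpl_mp, bpl_k. Qed.

Lemma bpl_cut A B C : BPL (A → B) -> BPL (B → C) -> BPL (A → C).
Proof. intros HAB HBC; eapply bpl_mp; [apply bpl_trans | apply bpl_conj; eassumption]. Qed.

Lemma bpl_glb A B C : BPL (C → A) -> BPL (C → B) -> BPL (C → A ∧ B).
Proof. intros HA HB; eapply bpl_mp; [apply bpl_and_intro | apply bpl_conj; assumption]. Qed.

Lemma bpl_lub A B C : BPL (A → C) -> BPL (B → C) -> BPL (A ∨ B → C).
Proof. intros HA HB; eapply bpl_mp; [apply bpl_or_elim | apply bpl_conj; assumption]. Qed.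

Lemma bpl_and_mono A A' B B' :
  BPL (A → A') -> BPL (B → B') -> BPL (A ∧ B → A' ∧ B').
Proof.
  intros HA HB; apply bpl_glb;
    eapply bpl_cut; [apply bpl_and_l | exact HA | apply bpl_and_r | exact HB].
Qed.

(** Each side is changed by the transitivity axiom, one conjunct of which is a theorem and so
    follows from anything by weakening. *)
Lemma bpl_imp_mono A A' B B' :
  BPL (A' → A) -> BPL (B → B') -> BPL ((A → B) → (A' → B')).
Proof.
  intros HA HB.
  apply bpl_cut with (A' → B)%bpl.
  - eapply bpl_cut; [|apply bpl_trans].
    apply bpl_glb; [apply bpl_weaken, HA | apply bpl_id].
  - eapply bpl_cut; [|apply bpl_trans].
    apply bpl_glb; [apply bpl_id | apply bpl_weaken, HB].
Qed.

Lemma bpl_or_elim_ctx A B C D :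
  BPL (D ∧ A → C) -> BPL (D ∧ B → C) -> BPL (D ∧ (A ∨ B) → C).
Proof.
  intros HA HB; eapply bpl_cut; [apply bpl_distr | apply bpl_lub; assumption].
Qed.

(** * Filters *)

(** Closure is under provable implication, not modus ponens: a filter may contain [a] and [a → b]
    without containing [b]. *)
Record filter : Type := {
  mem :> bpl_form -> Prop;
  mem_top : mem BTop;
  mem_up : forall a b, mem a -> BPL (a → b) -> mem b;
  mem_and : forall a b, mem a -> mem b -> mem (a ∧ b)%bpl }.

Arguments mem_up F {a} b : rename.

Definition subfilter (F G : filter) : Prop := forall a, F a -> G a.

Definition principal (a : bpl_form) : filter.
Proof.
  refine {| mem := fun c => BPL (a → c) |}.
  - apply bpl_top.
  - intros b c Hb Hbc; exact (bpl_cut _ _ _ Hb Hbc).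
  - intros b c Hb Hc; exact (bpl_glb _ _ _ Hb Hc).
Defined.

Definition inter (F G : filter) : filter.
Proof.
  refine {| mem := fun c => F c /\ G c |}.
  - split; apply mem_top.
  - intros a b [Fa Ga] Hab; split; eapply mem_up; eassumption.
  - intros a b [Fa Ga] [Fb Gb]; split; apply mem_and; assumption.
Defined.

(** The filter generated by the union, hence the meet for reverse inclusion. *)
Definition join (F G : filter) : filter.
Proof.
  refine {| mem := fun c => exists f g, F f /\ G g /\ BPL (f ∧ g → c) |}.
  - exists BTop, BTop; repeat split; try apply mem_top; apply bpl_top.
  - intros a b (f & g & Ff & Gg & H) Hab; exists f, g; repeat split; try assumption.
    eapply bpl_cut; eassumption.
  - intros a b (f & g & Ff & Gg & H) (f' & g' & Ff' & Gg' & H').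
    exists (f ∧ f')%bpl, (g ∧ g')%bpl.
    repeat split; try (apply mem_and; assumption).
    apply bpl_glb; eapply bpl_cut; [|exact H| |exact H'];
      apply bpl_and_mono; apply bpl_and_l || apply bpl_and_r.
Defined.

Definition prod (F G : filter) : filter.
Proof.
  refine {| mem := fun c => exists a, F a /\ G (a → c)%bpl |}.
  - exists BTop; split; [apply mem_top|].
    apply (mem_up G _ (mem_top G)), bpl_weaken, bpl_id.
  - intros c d (a & Fa & Gc) Hcd; exists a; split; [exact Fa|].
    apply (mem_up G _ Gc), bpl_imp_mono; [apply bpl_id | exact Hcd].
  - intros c d (a & Fa & Gc) (b & Fb & Gd).
    exists (a ∧ b)%bpl; split; [apply mem_and; assumption|].
    apply (mem_up G _ (mem_and G _ _ Gc Gd)).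
    eapply bpl_cut; [|apply bpl_and_intro].
    apply bpl_and_mono; apply bpl_imp_mono;
      apply bpl_and_l || apply bpl_and_r || apply bpl_id.
Defined.

Lemma subfilter_refl (F : filter) : subfilter F F.
Proof. intros a Fa; exact Fa. Qed.

Lemma subfilter_trans (F G H : filter) : subfilter F G -> subfilter G H -> subfilter F H.
Proof. intros FG GH a Fa; apply GH, FG, Fa. Qed.

Lemma subfilter_bot (F G : filter) : F BBot -> subfilter G F.
Proof. intros H a _; apply (mem_up F _ H), bpl_bot. Qed.

Lemma join_l (F G : filter) : subfilter F (join F G).
Proof.
  intros a Fa; exists a, BTop; repeat split; [exact Fa | apply mem_top | apply bpl_and_l].
Qed.

Lemma join_r (F G : filter) : subfilter G (join F G).
Proof.
  intros a Ga; exists BTop, a; repeat split; [apply mem_top | exact Ga | apply bpl_and_r].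
Qed.

(** If [f ∧ g] and [f' ∧ h] both imply [c], then [g ∨ h] lies in [G] and in [H], hence in [F], and
    distributivity yields [c] from [f], [f'] and [g ∨ h]. *)
Lemma inter_join_distr (F G H : filter) :
  subfilter (inter G H) F -> subfilter (inter (join F G) (join F H)) F.
Proof.
  intros GHF c [(f & g & Ff & Gg & Hc) (f' & h & Ff' & Hh & Hc')].
  assert (F (g ∨ h)%bpl) as Fgh.
  { apply GHF; split.
    - apply (mem_up G _ Gg), bpl_or_l.
    - apply (mem_up H _ Hh), bpl_or_r. }
  apply (mem_up F _ (mem_and F _ _ (mem_and F _ _ Ff Ff') Fgh)).
  apply bpl_or_elim_ctx; eapply bpl_cut; [|exact Hc| |exact Hc'];
    apply bpl_and_mono; apply bpl_and_l || apply bpl_and_r || apply bpl_id.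
Qed.

Lemma prod_mono (F F' G G' : filter) :
  subfilter F F' -> subfilter G G' -> subfilter (prod F G) (prod F' G').
Proof. intros HF HG c (a & Fa & Gc); exists a; auto. Qed.

Lemma prod_fst (F G : filter) : subfilter F (prod F G).
Proof.
  intros a Fa; exists a; split; [exact Fa|].
  apply (mem_up G _ (mem_top G)), bpl_weaken, bpl_id.
Qed.

Lemma prod_snd (F G : filter) : subfilter G (prod F G).
Proof.
  intros a Ga; exists BTop; split; [apply mem_top|].
  apply (mem_up G _ Ga), bpl_k.
Qed.

(** The transitivity axiom read in [G]; under reverse inclusion it is the contraction axiom of
    SRBL. *)
Lemma prod_contr (F G : filter) : subfilter (prod (prod F G) G) (prod F G).
Proof.
  intros c (b & (a & Fa & Gab) & Gbc); exists a; split; [exact Fa|].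
  apply (mem_up G _ (mem_and G _ _ Gab Gbc)), bpl_trans.
Qed.

Lemma prod_inter_l (F F' G : filter) :
  subfilter (inter (prod F G) (prod F' G)) (prod (inter F F') G).
Proof.
  intros c [(a & Fa & Gac) (b & Fb & Gbc)].
  exists (a ∨ b)%bpl; split.
  - split; [apply (mem_up F _ Fa), bpl_or_l | apply (mem_up F' _ Fb), bpl_or_r].
  - apply (mem_up G _ (mem_and G _ _ Gac Gbc)), bpl_or_elim.
Qed.

Lemma prod_inter_r (F G G' : filter) :
  subfilter (inter (prod F G) (prod F G')) (prod F (inter G G')).
Proof.
  intros c [(a & Fa & Gac) (b & Fb & Gbc)].
  exists (a ∧ b)%bpl; split; [apply mem_and; assumption|]; split.
  - apply (mem_up G _ Gac), bpl_imp_mono; [apply bpl_and_l | apply bpl_id].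
  - apply (mem_up G' _ Gbc), bpl_imp_mono; [apply bpl_and_r | apply bpl_id].
Qed.

(** Among all antecedents that [a] implies, [a] itself gives the weakest implication. *)
Lemma prod_principal (F : filter) a c : prod (principal a) F c <-> F (a → c)%bpl.
Proof.
  split.
  - intros (b & Hab & Fbc); apply (mem_up F _ Fbc), bpl_imp_mono;
      [exact Hab | apply bpl_id].
  - intros Fac; exists a; split; [apply bpl_id | exact Fac].
Qed.

(** * The ideal model of SRBL *)

(** Each [sem A] is an ideal for reverse inclusion, as the next three lemmas show. The clauses for
    [ROr] and [RDot] take the downward closure of joins and products; those for [RImp] and [RPmi]
    are the residuals. *)
Fixpoint sem (A : rbl_form) (F : filter) : Prop :=
  match A with
  | RVar p => F (BVar p)
  | RBot => F BBot
  | RTop => True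
  | RAnd A B => sem A F /\ sem B F
  | ROr A B => exists G H, sem A G /\ sem B H /\ subfilter (inter G H) F
  | RImp A B => forall G, sem A G -> sem B (prod G F)
  | RDot A B => exists G H, sem A G /\ sem B H /\ subfilter (prod G H) F
  | RPmi A B => forall G, sem B G -> sem A (prod F G)
  end.

Lemma sem_mono A F G : subfilter F G -> sem A F -> sem A G.
Proof.
  revert F G; induction A as [p| | |A IHA B IHB|A IHA B IHB|A IHA B IHB
                             |A IHA B IHB|A IHA B IHB]; cbn; intros F G FG.
  - apply FG.
  - apply FG.
  - tauto.
  - intros [HA HB]; split; eauto.
  - intros (F1 & F2 & H1 & H2 & H); exists F1, F2; repeat split; try assumption.
    exact (subfilter_trans _ _ _ H FG).
  - intros H K HK; apply (IHB (prod K F)); [|apply H, HK].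
    apply prod_mono; [apply subfilter_refl | exact FG].
  - intros (F1 & F2 & H1 & H2 & H); exists F1, F2; repeat split; try assumption.
    exact (subfilter_trans _ _ _ H FG).
  - intros H K HK; apply (IHA (prod F K)); [|apply H, HK].
    apply prod_mono; [exact FG | apply subfilter_refl].
Qed.

(** Closure under finite joins, required by the left rule for disjunction. The residuals inherit it
    because [prod] preserves intersections in each argument. *)
Lemma sem_inter A F G : sem A F -> sem A G -> sem A (inter F G).
Proof.
  revert F G; induction A as [p| | |A IHA B IHB|A IHA B IHB|A IHA B IHB
                             |A IHA B IHB|A IHA B IHB]; cbn; intros F G.
  - tauto.
  - tauto.
  - tauto.
  - intros [HA HB] [HA' HB']; auto.
  - intros (F1 & F2 & H1 & H2 & H) (G1 & G2 & H1' & H2' & H').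
    exists (inter F1 G1), (inter F2 G2); split; [auto | split; [auto|]].
    intros c [[F1c G1c] [F2c G2c]]; split; [apply H | apply H']; split; assumption.
  - intros HF HG K HK; apply (sem_mono _ _ _ (prod_inter_r K F G)); auto.
  - intros (F1 & F2 & H1 & H2 & H) (G1 & G2 & H1' & H2' & H').
    exists (inter F1 G1), (inter F2 G2); split; [auto | split; [auto|]].
    intros c (a & [F1a G1a] & [F2c G2c]).
    split; [apply H | apply H']; exists a; split; assumption.
  - intros HF HG K HK; apply (sem_mono _ _ _ (prod_inter_l F G K)); auto.
Qed.

Lemma sem_bot A (F : filter) : F BBot -> sem A F.
Proof.
  revert F; induction A as [p| | |A IHA B IHB|A IHA B IHB|A IHA B IHB
                           |A IHA B IHB|A IHA B IHB]; cbn; intros F HF.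
  - apply (mem_up F _ HF), bpl_bot.
  - exact HF.
  - exact I.
  - auto.
  - exists F, F; repeat split; auto using subfilter_bot.
  - intros G _; apply IHB, prod_snd, HF.
  - exists F, F; repeat split; auto using subfilter_bot.
  - intros G _; apply IHA, prod_fst, HF.
Qed.

Lemma sem_sound A B : (A ⇒ B) -> forall F, sem A F -> sem B F.
Proof.
  induction 1 as [A|A|A|A B C|A|A|A B|A B C _ IH1 _ IH2|A B C _ IH|A B C _ IH
                 |A B C _ IH|A B C _ IH|A1 A2 B _ IH|A1 A2 B _ IH
                 |A B C _ IH1 _ IH2|A B C _ IH1 _ IH2|A1 A2 C _ IH|A1 A2 C _ IH];
    cbn in *; intros F.
  - auto.
  - apply sem_bot.
  - auto.
  - intros [HA (G & H & HB & HC & GH)].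
    (* Truth persists to larger filters, so [join F G] satisfies both [A] and [B], and [join F H]
       both [A] and [C]. *)
    exists (join F G), (join F H); repeat split.
    + exact (sem_mono _ _ _ (join_l F G) HA).
    + exact (sem_mono _ _ _ (join_r F G) HB).
    + exact (sem_mono _ _ _ (join_l F H) HA).
    + exact (sem_mono _ _ _ (join_r F H) HC).
    + exact (inter_join_distr _ _ _ GH).
  - intros (G & H & HA & _ & GH); apply (sem_mono A G); [|exact HA].
    exact (subfilter_trans _ _ _ (prod_fst G H) GH).
  - intros (G & H & _ & HA & GH); apply (sem_mono A H); [|exact HA].
    exact (subfilter_trans _ _ _ (prod_snd G H) GH).
  - intros (G & H & HA & HB & GH).
    exists (prod G H), H; repeat split; [|exact HB|].
    + exists G, H; auto using subfilter_refl.
    + exact (subfilter_trans _ _ _ (prod_contr G H) GH).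
  - auto.
  - intros HB G HA; apply IH; exists G, F; auto using subfilter_refl.
  - intros (G & H & HA & HB & GH); apply (sem_mono _ _ _ GH); auto.
  - intros HA G HB; apply IH; exists F, G; auto using subfilter_refl.
  - intros (G & H & HA & HB & GH); apply (sem_mono _ _ _ GH); auto.
  - intros [H _]; auto.
  - intros [_ H]; auto.
  - auto.
  - intros (G & H & HA & HB & GH); apply (sem_mono _ _ _ GH), sem_inter; auto.
  (* The improper filter satisfies every formula and is neutral for [inter], so it serves as the
     missing disjunct. *)
  - intros H; exists F, (principal BBot); repeat split; auto.
    + apply sem_bot; cbn; apply bpl_id.
    + intros c [Fc _]; exact Fc.
  - intros H; exists (principal BBot), F; repeat split; auto.
    + apply sem_bot; cbn; apply bpl_id.
    + intros c [_ Fc]; exact Fc.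
Qed.

(** Truth lemma: the ideal of an embedded formula is the principal one below [principal a]. *)
Lemma sem_embed a (F : filter) : sem (embed a) F <-> F a.
Proof.
  revert F; induction a as [p| | |a IHa b IHb|a IHa b IHb|a IHa b IHb]; cbn; intros F.
  - tauto.
  - tauto.
  - split; [intros _; apply mem_top | auto].
  - split.
    + intros [Fa Fb]; apply mem_and; [apply IHa, Fa | apply IHb, Fb].
    + intros Fab; split; [apply IHa | apply IHb]; apply (mem_up F _ Fab); [apply bpl_and_l | apply bpl_and_r].
  - split.
    + intros (G & H & Ga & Hb & GH); apply IHa in Ga; apply IHb in Hb.
      apply GH; split; [apply (mem_up G _ Ga), bpl_or_l | apply (mem_up H _ Hb), bpl_or_r].
    + intros Fab.
      (* Adjoining [a] and [b] separately loses nothing: as [F] contains [a ∨ b], the two extensions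
         intersect inside [F]. *)
      exists (join F (principal a)), (join F (principal b)); repeat split.
      * apply IHa, join_r; cbn; apply bpl_id.
      * apply IHb, join_r; cbn; apply bpl_id.
      * apply inter_join_distr; intros c [Hac Hbc].
        apply (mem_up F _ Fab), bpl_lub; assumption.
  - split.
    (* The hypothesis is tested on the least filter containing [a]. *)
    + intros H; apply prod_principal, IHb, H, IHa; cbn; apply bpl_id.
    + intros Fab G Ga; apply IHb; apply IHa in Ga; exists a; auto.
Qed.

Theorem theorem5 (A : bpl_form) :
  BPL A <-> SRBL RTop (embed A) /\ SRBL (embed A) RTop.
Proof.
  split.
  - intros H; split; [apply slash_srbl, bpl_slash, H | apply srbl_top].
  - intros [H _].
    pose proof (sem_sound _ _ H (principal BTop) I) as HA.
    apply sem_embed in HA; cbn in HA.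
    (* Membership in [principal BTop] gives only [⊤ → A]; a proof of [⊤] comes from [bpl_top]
       applied to a theorem. *)
    apply bpl_mp with BTop; [exact HA|].
    apply bpl_mp with (BBot → BBot)%bpl; [apply bpl_top | apply bpl_id].
Qed.
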